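(* Let $\Omega\subseteq\mathbb{R}^n$ be open, $\nu,C_1,\dots,C_{n-1}\in\mathcal{C}^\infty(\Omega,\mathbb{R})$, $H:=C_{n-1}$, and $X$ the vector field on $\Omega$ with components $X_i=\nu\cdot\frac{\partial(C_1,\dots,C_{n-2},x_i,H)}{\partial(x_1,\dots,x_n)}$. Let $\overline{x}_e\in\mathcal{E}^{C_{n-1}}_{C_1,\dots,C_{n-2}}$ be a non-degenerate regular equilibrium point of $X$. If $\mathcal{I}_X(\overline{x}_e)>0$, then $\overline{x}_e$ is a Lyapunov stable equilibrium of $X$.
   Context: $\langle\cdot,\cdot\rangle$ is the standard inner product on $\mathbb{R}^n$, $\nabla$ the gradient, and $\frac{\partial(\cdots)}{\partial(x_1,\dots,x_n)}$ a Jacobian determinant. For decomposable $k$-vectors, $\langle u_1\wedge\dots\wedge u_k,v_1\wedge\dots\wedge v_k\rangle_k:=\det[\langle u_i,v_j\rangle]$. $\mathcal{E}^{C_{n-1}}_{C_1,\dots,C_{n-2}}:=\{\overline{x}\in\Omega:\nu(\overline{x})\neq0,\ \nabla C_1\wedge\dots\wedge\nabla C_{n-2}(\overline{x})\neq0,\ \nabla C_1\wedge\dots\wedge\nabla C_{n-1}(\overline{x})=0\}$. For $\overline{x}_e$ in it, let $\overrightarrow{\lambda_e}\in\mathbb{R}^{n-2}$ be the unique vector with $\nabla H(\overline{x}_e)+\sum_i\lambda^e_i\nabla C_i(\overline{x}_e)=0$, $F_{\overrightarrow{\lambda_e}}:=H+\sum_i\lambda^e_iC_i$; $\overline{x}_e$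 is non-degenerate if $A:=\operatorname{Hess}F_{\overrightarrow{\lambda_e}}(\overline{x}_e)=\mathrm{D}(\nabla F_{\overrightarrow{\lambda_e}})(\overline{x}_e)$ is invertible, and then $\mathcal{I}_X(\overline{x}_e):=\nu^2(\overline{x}_e)\det(A)\langle A^{-1}\nabla C_1(\overline{x}_e)\wedge\dots\wedge A^{-1}\nabla C_{n-2}(\overline{x}_e),\nabla C_1(\overline{x}_e)\wedge\dots\wedge\nabla C_{n-2}(\overline{x}_e)\rangle_{n-2}$. *)

(* Defs.v *)
From HB Require Import structures.
From mathcomp Require Import all_boot all_order all_algebra.
From mathcomp Require Import all_classical all_reals all_analysis.
Set Implicit Arguments. Unset Strict Implicit. Unset Printing Implicit Defensive.
Import Order.TTheory GRing.Theory Num.Theory numFieldNormedType.Exports.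
Local Open Scope ring_scope.
Local Open Scope classical_set_scope.

Definition ebasis (R : realType) (n : nat) (i : 'I_n) : 'rV[R]_n := delta_mx 0 i.

Definition partial (R : realType) (n : nat) (f : 'rV[R]_n.+1 -> R) (i : 'I_n.+1)
  : 'rV[R]_n.+1 -> R := fun x => derive f x (ebasis R i).

Definition iter_partial (R : realType) (n : nat) (l : seq 'I_n.+1)
  (f : 'rV[R]_n.+1 -> R) : 'rV[R]_n.+1 -> R :=
  foldr (fun i g => partial g i) f l.

Definition smooth_on (R : realType) (n : nat) (O : set 'rV[R]_n.+1)
  (f : 'rV[R]_n.+1 -> R) : Prop :=
  forall l : seq 'I_n.+1, forall x, O x ->
    {for x, continuous (iter_partial l f)} /\
    (forall i, derivable (iter_partial l f) x (ebasis R i)).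

Definition grad (R : realType) (n : nat) (f : 'rV[R]_n.+1 -> R) (x : 'rV[R]_n.+1)
  : 'rV[R]_n.+1 := \row_i partial f i x.

Definition hess (R : realType) (n : nat) (f : 'rV[R]_n.+1 -> R) (x : 'rV[R]_n.+1)
  : 'M[R]_n.+1 := \matrix_(i, j) partial (partial f i) j x.

Definition gradmx (R : realType) (n k : nat) (C : 'I_k -> 'rV[R]_n.+1 -> R)
  (x : 'rV[R]_n.+1) : 'M[R]_(k, n.+1) := \matrix_(i, j) grad (C i) x 0 j.

(* the decomposable k-vector u_1 /\ ... /\ u_k (u_i the rows of U), given by
   its coordinates: the coefficient attached to e_{f 0} /\ ... /\ e_{f (k-1)}
   is the k x k minor det (colsub f U). *)
Definition wedge (R : realType) (k n : nat) (U : 'M[R]_(k, n))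
  : {ffun {ffun 'I_k -> 'I_n} -> R} := [ffun f : {ffun 'I_k -> 'I_n} => \det (colsub f U)].

(* < u_1/\../\u_k , v_1/\../\v_k >_k := det [<u_i, v_j>] *)
Definition kpairing (R : realType) (k n : nat) (U V : 'M[R]_(k, n)) : R :=
  \det (\matrix_(i, j) \sum_l U i l * V j l).

(* n = m.+2 ; C : 'I_m.+1 -> _ encodes C_1,...,C_{n-1}; H = C ord_max *)
Definition firstC (R : realType) (m : nat) (C : 'I_m.+1 -> 'rV[R]_m.+2 -> R)
  : 'I_m -> 'rV[R]_m.+2 -> R := fun i => C (widen_ord (leqnSn m) i).

Definition jac_mx (R : realType) (m : nat) (C : 'I_m.+1 -> 'rV[R]_m.+2 -> R)
  (i : 'I_m.+2) (x : 'rV[R]_m.+2) : 'M[R]_m.+2 :=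
  \matrix_(k, j)
    (if (k < m)%N then grad (C (inord k)) x 0 j
     else if (k == m :> nat) then ebasis R i 0 j
     else grad (C ord_max) x 0 j).

Definition vfield (R : realType) (m : nat) (nu : 'rV[R]_m.+2 -> R)
  (C : 'I_m.+1 -> 'rV[R]_m.+2 -> R) (x : 'rV[R]_m.+2) : 'rV[R]_m.+2 :=
  \row_i (nu x * \det (jac_mx C i x)).

Definition equil_set (R : realType) (m : nat) (O : set 'rV[R]_m.+2)
  (nu : 'rV[R]_m.+2 -> R) (C : 'I_m.+1 -> 'rV[R]_m.+2 -> R) : set 'rV[R]_m.+2 :=
  [set x | O x /\ nu x != 0 /\ wedge (gradmx (firstC C) x) != 0
           /\ wedge (gradmx C x) = 0].

Definition Flam (R : realType) (m : nat) (C : 'I_m.+1 -> 'rV[R]_m.+2 -> R)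
  (lam : 'rV[R]_m) : 'rV[R]_m.+2 -> R :=
  fun x => C ord_max x + \sum_(i < m) lam 0 i * firstC C i x.

(* I_X(x_e) = nu^2 det(A) < A^-1 grad C_1 /\ ... , grad C_1 /\ ... >_{n-2} *)
Definition index_IX (R : realType) (m : nat) (nu : 'rV[R]_m.+2 -> R)
  (C : 'I_m.+1 -> 'rV[R]_m.+2 -> R) (lam : 'rV[R]_m) (xe : 'rV[R]_m.+2) : R :=
  let A := hess (Flam C lam) xe in
  let G := gradmx (firstC C) xe in
  nu xe ^+ 2 * \det A * kpairing (G *m (invmx A)^T) G.

Definition lyapunov_stable (R : realType) (n : nat) (O : set 'rV[R]_n.+1)
  (X : 'rV[R]_n.+1 -> 'rV[R]_n.+1) (xe : 'rV[R]_n.+1) : Prop :=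
  forall eps : R, 0 < eps -> exists2 delta : R, 0 < delta &
    forall (T : \bar R) (g : R -> 'rV[R]_n.+1),
      (forall t : R, 0 <= t -> (t%:E < T)%E ->
         O (g t) /\ is_derive t 1 g (X (g t))) ->
      `|g 0 - xe| < delta ->
      forall t : R, 0 <= t -> (t%:E < T)%E -> `|g t - xe| < eps.

(* Main.v *)
(** Along X the functions C_1, ..., C_{n-1} are conserved, because the
    derivative of C_j along X is nu times a determinant with two equal rows.
    Hence so is [V := 2 s (F - F xe) + 2 K \sum_i (C_i - C_i xe)^2], where
    [F := H + \sum_i lam_i C_i] is critical at [xe].  Let A be the Hessian of F
    at [xe] and G the Jacobian of (C_1, ..., C_{n-2}).  With B a basis of the
    plane ker G and [P] the matrix with row blocks [B] and [G A^-1],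
    [P A P^T] is block diagonal with blocks [Q := B A B^T] and
    [D := G A^-1 G^T], so [0 < det A * det D] forces [0 < det Q]: A is definite
    on ker G.  Taking [s := tr Q] and K large, V has a nondegenerate minimum
    at [xe], so V traps the trajectories starting near [xe]. *)
Require Import Defs.
From HB Require Import structures.
From mathcomp Require Import all_boot all_order all_algebra.
From mathcomp Require Import all_classical all_reals all_analysis.
From mathcomp Require Import ring lra.
Import Order.TTheory GRing.Theory Num.Theory numFieldNormedType.Exports.
Local Open Scope ring_scope.
Local Open Scope classical_set_scope.

(** * Differential calculus in several variables, up to Taylor's formula of order two *)

Lemma derivable_line (R : realType) (V W : normedModType R) (f : V -> W) (x v : V) (t : R) :
  derivable f (x + t *: v) v -> derivable (fun s : R => f (x + s *: v)) t 1.
Proof.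
rewrite /derivable; set g1 := fun h => h^-1 *: _; set g2 := fun h => h^-1 *: _.
suff -> : g1 = g2 by [].
apply/funext => h; rewrite /g1 /g2 /=; congr (_ *: (f _ - _)).
by rewrite [_%:A]mulr1 scalerDl addrCA.
Qed.

Lemma derive_line (R : realType) (V W : normedModType R) (f : V -> W) (x v : V) (t : R) :
  'D_1 (fun s : R => f (x + s *: v)) t = 'D_v f (x + t *: v).
Proof.
rewrite /derive; set g1 := fun h => h^-1 *: _; set g2 := fun h => h^-1 *: _.
suff -> : g1 = g2 by [].
apply/funext => h; rewrite /g1 /g2 /=; congr (_ *: (f _ - _)).
by rewrite [_%:A]mulr1 scalerDl addrCA.
Qed.

(** This is the mean value theorem for the restriction of [f] to a line. Locating [c] only by
    [|c| <= |s|] leaves the sign of [s] free, as needed when [s] is a coordinate of a vector. *)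
Lemma MVT_line (R : realType) (V : normedModType R) (f : V -> R) (x v : V) (s : R) :
  (forall t : R, `|t| <= `|s| -> derivable f (x + t *: v) v) ->
  exists2 c : R, `|c| <= `|s| & f (x + s *: v) - f x = s * 'D_v f (x + c *: v).
Proof.
move=> df.
pose phi t := f (x + t *: v).
have dphi (t : R) : `|t| <= `|s| -> is_derive t 1 phi ('D_v f (x + t *: v)).
  by move=> ts; rewrite -derive_line; apply/derivableP/derivable_line/df.
have phi0 : phi 0 = f x by rewrite /phi scale0r addr0.
have cphi (a b : R) : (forall t : R, t \in `[a, b]%R -> `|t| <= `|s|) ->
    {within `[a, b], continuous phi}.
  move=> H; apply: derivable_within_continuous => t tab.
  by have [] := dphi t (H t tab).
have [s0|s0] := leP 0 s.
  have H (t : R) : t \in `[0, s]%R -> `|t| <= `|s|.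
    by rewrite in_itv/= => /andP[t0 ts]; rewrite !ger0_norm.
  have [|c cs] := @MVT_segment R phi (fun c => 'D_v f (x + c *: v)) _ _ s0 _ (cphi _ _ H).
    by move=> t ts; apply: dphi; apply: H; exact: subset_itv_oo_cc.
  rewrite phi0 subr0 mulrC => E.
  by exists c => //; exact: H.
have H (t : R) : t \in `[s, 0]%R -> `|t| <= `|s|.
  by rewrite in_itv/= => /andP[t0 ts]; rewrite !ler0_norm ?lerN2// ltW.
have [|c cs] := @MVT_segment R phi (fun c => 'D_v f (x + c *: v)) _ _ (ltW s0) _ (cphi _ _ H).
  by move=> t ts; apply: dphi; apply: H; exact: subset_itv_oo_cc.
rewrite phi0 sub0r mulrN => E.
exists c; first exact: H.
by rewrite -[LHS]opprB E opprK mulrC.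
Qed.

Lemma rV_norm_coord (R : realType) (n : nat) (h : 'rV[R]_n.+1) (i : 'I_n.+1) :
  `|h 0 i| <= `|h|.
Proof.
rewrite [leRHS]/Num.Def.normr/= mx_normrE.
exact: (le_bigmax _ (fun ij : 'I_1 * 'I_n.+1 => `|h ij.1 ij.2|) (0, i)).
Qed.

Lemma rV_norm_le (R : realType) (n : nat) (h : 'rV[R]_n.+1) (r : R) :
  0 <= r -> (forall i, `|h 0 i| <= r) -> `|h| <= r.
Proof.
move=> r0 H; rewrite [leLHS]/Num.Def.normr/= mx_normrE.
by apply: bigmax_le => // -[i j] _ /=; rewrite (ord1 i).
Qed.

(** Walk from [x] to [x + h] changing one coordinate at a time, with the mean value theorem on each
    leg. The path stays in the ball because the norm is the maximum norm. *)
Lemma increment_approx (R : realType) (n : nat) (f : 'rV[R]_n.+1 -> R)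
    (x : 'rV[R]_n.+1) (c : 'I_n.+1 -> R) (r e : R) :
  (forall y i, `|y - x| < r -> derivable f y (ebasis R i)) ->
  (forall y i, `|y - x| < r -> `|partial f i y - c i| <= e) ->
  forall h, `|h| < r ->
    `|f (x + h) - f x - \sum_i h 0 i * c i| <= n.+1%:R * e * `|h|.
Proof.
move=> df pf h hr.
(* [tr k] keeps the first [k] coordinates of [h]: the points [x + tr k] are the corners of the
   path. *)
pose tr (k : nat) : 'rV[R]_n.+1 := \row_j (if (j < k)%N then h 0 j else 0).
have trS (k : 'I_n.+1) : tr k.+1 = tr k + h 0 k *: ebasis R k.
  apply/rowP => j; rewrite !mxE eqxx/= ltnS leq_eqVlt.
  have [/val_inj ->|jk] /= := eqVneq (j : nat) k.
    by rewrite ltnn eqxx mulr1 add0r.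
  rewrite (_ : (j == k) = false); last by apply/negbTE.
  by rewrite mulr0 addr0.
have tr0 : tr 0 = 0 by apply/rowP => j; rewrite !mxE.
have trn : tr n.+1 = h by apply/rowP => j; rewrite !mxE ltn_ord.
have trh (k : 'I_n.+1) (t : R) : `|t| <= `|h 0 k| ->
    `|x + tr k + t *: ebasis R k - x| < r.
  move=> th; apply: le_lt_trans hr; rewrite -[x + _ + _]addrA [x + _]addrC addrK.
  apply: rV_norm_le => // j; rewrite !mxE eqxx/=.
  have [->|jk] := eqVneq j k.
    by rewrite ltnn add0r mulr1 (le_trans th)// rV_norm_coord.
  rewrite mulr0 addr0; case: ifP => _; first exact: rV_norm_coord.
  by rewrite normr0.
have -> : f (x + h) - f x = \sum_(k < n.+1) (f (x + tr k.+1) - f (x + tr k)).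
  rewrite -(big_mkord xpredT (fun k => f (x + tr k.+1) - f (x + tr k))).
  by rewrite (telescope_sumr (fun k => f (x + tr k)))// trn tr0 addr0.
rewrite -sumrB; apply: (le_trans (ler_norm_sum _ _ _)).
rewrite -mulrA -[X in X%:R](card_ord n.+1) mulr_natl -sumr_const.
apply: ler_sum => k _; rewrite trS addrA.
have [|s sh ->] := @MVT_line R _ f (x + tr k) (ebasis R k) (h 0 k).
  by move=> t th; apply/df/trh.
rewrite -mulrBr normrM mulrC ler_pM ?normr_ge0//.
  exact/pf/trh.
exact: rV_norm_coord.
Qed.

(** The linear map with coefficients [c] is continuous, so uniqueness of differentials identifies it
    with ['d f x]. *)
Lemma differentiable_approx (R : realType) (n : nat) (f : 'rV[R]_n.+1 -> R)
    (x : 'rV[R]_n.+1) (c : 'I_n.+1 -> R) :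
  (forall e : R, 0 < e -> \forall h \near (0 : 'rV[R]_n.+1),
    `|f (x + h) - f x - \sum_i h 0 i * c i| <= e * `|h|) ->
  differentiable f x.
Proof.
move=> fc.
pose d (h : 'rV[R]_n.+1) : R := \sum_i h 0 i * c i.
have lin_d : linear d.
  move=> a u v; rewrite /d scaler_sumr -big_split/=; apply: eq_bigr => i _.
  by rewrite !mxE mulrDl -mulrA.
pose dM := GRing.isLinear.Build _ _ _ _ _ lin_d.
pose dL : {linear 'rV[R]_n.+1 -> R} := HB.pack d dM.
have dC : continuous dL.
  rewrite (_ : (dL : _ -> _) = \sum_i (fun h : 'rV[R]_n.+1 => h 0 i * c i)).
    move=> h; apply: differentiable_continuous.
    apply: differentiable_sum => i; apply: differentiableM => //.
    exact: differentiable_coord.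
  by apply/funext => h; rewrite fct_sumE.
have small e : 0 < e -> \forall h \near (0 : 'rV[R]_n.+1),
    `|f (h + x) - (f x + d h)| <= e * `|h|.
  by move=> e0; near=> h; rewrite opprD addrA [h + x]addrC; near: h; exact: fc.
have dfE : 'd f x = dL :> ('rV[R]_n.+1 -> R).
  by apply: diff_unique dC _; apply/eqaddoP => e e0; exact: small.
apply/diff_locallyP; rewrite dfE; split => //.
by apply/eqaddoP => e e0; exact: small.
Unshelve. all: by end_near. Qed.

(** By continuity each partial derivative stays within [e / n.+1] of its value at [x];
    [increment_approx] then gives a total error [e * |h|]. *)
Lemma differentiable_partials (R : realType) (n : nat) (f : 'rV[R]_n.+1 -> R)
    (x : 'rV[R]_n.+1) :
  (\forall y \near x, forall i, derivable f y (ebasis R i)) ->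
  (forall i, {for x, continuous (partial f i)}) ->
  differentiable f x.
Proof.
move=> df cf; apply: (@differentiable_approx _ _ _ _ (partial f ^~ x)) => e e0.
have : \forall y \near x, forall i, derivable f y (ebasis R i) /\
    `|partial f i x - partial f i y| <= e / n.+1%:R.
  near=> y => i; split; move: i; near: y => //; apply: filter_forall => i.
  by apply: (@cvgr_dist_le _ _ _ _ _ _ _ (cf i)); rewrite divr_gt0.
move=> /nbhs_normP[r /= r0 H]; apply/nbhs_normP; exists r => //= h /=.
rewrite sub0r normrN => hr.
rewrite (_ : e = n.+1%:R * (e / n.+1%:R)); last by rewrite mulrC divfK.
apply: increment_approx hr => y i yr.
  by have [|] := H y _ i => //; rewrite /= distrC.
by have [|_ Hy] := H y _ i; [rewrite /= distrC | rewrite distrC].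
Unshelve. all: by end_near. Qed.

Lemma diff_partial (R : realType) (n : nat) (f : 'rV[R]_n.+1 -> R)
    (x h : 'rV[R]_n.+1) : differentiable f x ->
  'd f x h = \sum_i h 0 i * partial f i x.
Proof.
move=> df; rewrite [in LHS](row_sum_delta h) linear_sum; apply: eq_bigr => i _.
by rewrite linearZ /partial deriveE.
Qed.

Lemma diff_approx (R : realType) (n : nat) (f : 'rV[R]_n.+1 -> R)
    (x : 'rV[R]_n.+1) (e : R) : differentiable f x -> 0 < e ->
  exists2 r, 0 < r & forall h, `|h| < r ->
    `|f (x + h) - f x - 'd f x h| <= e * `|h|.
Proof.
move=> /diff_locallyP[_ /eqaddoP df] e0.
have /nbhs_normP[r /= r0 H] := df e e0; exists r => // h hr.
have := H h; rewrite /= sub0r normrN => /(_ hr).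
rewrite -[X in `|X| <= _ -> _]/(f (h + x) - (f x + 'd f x h)).
by rewrite opprD addrA [h + x]addrC.
Qed.

Lemma ebasis_norm (R : realType) (n : nat) (i : 'I_n.+1) : `|ebasis R i| <= 1.
Proof.
apply: rV_norm_le => // j; rewrite mxE eqxx/=.
by case: eqP => _; rewrite ?normr1 ?normr0.
Qed.

(** The second difference is the increment along [e_i] of [phi y := f (y + t e_j) - f y]. The mean
    value theorem turns it into a difference of two values of [partial f i], and the differential of
    [partial f i] at [x] evaluates both. *)
Lemma second_difference_approx (R : realType) (n : nat) (f : 'rV[R]_n.+1 -> R)
    (x : 'rV[R]_n.+1) (i j : 'I_n.+1) (e : R) :
  (\forall y \near x, derivable f y (ebasis R i)) ->
  differentiable (partial f i) x -> 0 < e ->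
  exists2 r : R, 0 < r & forall t : R, 0 < t -> t < r ->
    `|f (x + t *: ebasis R i + t *: ebasis R j) - f (x + t *: ebasis R i)
      - (f (x + t *: ebasis R j) - f x) - t ^+ 2 * partial (partial f i) j x|
    <= e * t ^+ 2.
Proof.
move=> /nbhs_normP[r1 /= r10 df] dp e0.
(* The expansion is used at displacements of norm at most [2 t] and [t], whose errors add up to
   [e / 3 * (2 t) + e / 3 * t = e t]. *)
have [|r2 r20 dpe] := @diff_approx _ _ _ _ (e / 3) dp; first by rewrite divr_gt0.
exists (Num.min r1 r2 / 2); first by rewrite divr_gt0// lt_min r10.
move=> t t0; rewrite ltr_pdivlMr// lt_min => /andP[tr1 tr2].
set ei := ebasis R i; set ej := ebasis R j; set p := partial f i.
have nst (a b : R) : `|a| <= t -> `|b| <= t -> `|a *: ei + b *: ej| <= t * 2.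
  move=> at_ bt; rewrite (le_trans (ler_normD _ _))// mulrDr mulr1 !normrZ.
  rewrite lerD// -[leRHS]mulr1 ler_pM// ?normr_ge0//; exact: ebasis_norm.
have derivable_x (a b : R) : `|a| <= t -> `|b| <= t ->
    derivable f (x + a *: ei + b *: ej) ei.
  move=> at_ bt; apply: df; rewrite /= -addrA opprD addrA subrr sub0r normrN.
  by rewrite (le_lt_trans (nst _ _ _ _)).
have tt : `|t| <= t by rewrite ger0_norm// ltW.
have t00 : `|0 : R| <= t by rewrite normr0 ltW.
pose phi y := f (y + t *: ej) - f y.
have is_phi (c : R) : `|c| <= t ->
    is_derive (x + c *: ei) ei phi (p (x + c *: ei + t *: ej) - p (x + c *: ei)).
  move=> ct; apply: is_deriveB.
    have -> : (fun y => f (y + t *: ej)) = f \o shift (t *: ej) by [].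
    have := derivable_x c t ct tt.
    rewrite /p /partial -/ei => d.
    split.
      move: d; rewrite /derivable; set g1 := fun h => h^-1 *: _.
      set g2 := fun h => h^-1 *: _.
      suff -> : g1 = g2 by [].
      by apply/funext => h; rewrite /g1 /g2 /= !addrA.
    rewrite /derive; set g1 := fun h => h^-1 *: _; set g2 := fun h => h^-1 *: _.
    suff -> : g1 = g2 by [].
    by apply/funext => h; rewrite /g1 /g2 /= !addrA.
  apply: derivableP.
  by have := derivable_x c 0 ct t00; rewrite scale0r addr0.
have [|c ct E] := @MVT_line R _ phi x ei t.
  by move=> s st; have [] := is_phi s (le_trans st tt).
have {}ct := le_trans ct tt.
rewrite -/(phi x) -/(phi (x + t *: ei)) E.
have [_ ->] := is_phi c ct.
have l1 : `|p (x + (c *: ei + t *: ej)) - p x - 'd p x (c *: ei + t *: ej)|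
    <= e / 3 * (t * 2).
  apply: (le_trans (dpe _ _)); first by rewrite (le_lt_trans (nst _ _ _ _)).
  by rewrite ler_wpM2l ?nst// divr_ge0// ltW.
have nce : `|c *: ei| <= t.
  by rewrite normrZ -[leRHS]mulr1 ler_pM// ?normr_ge0//; exact: ebasis_norm.
have l2 : `|p (x + c *: ei) - p x - 'd p x (c *: ei)| <= e / 3 * t.
  apply: (le_trans (dpe _ _)); last by rewrite ler_wpM2l// divr_ge0// ltW.
  by rewrite (le_lt_trans nce)// (le_lt_trans _ tr2)// ler_peMr ?ler1n// ltW.
rewrite (_ : partial p j x = 'd p x ej); last by rewrite -deriveE.
rewrite expr2 -[t * t * 'd p x ej]mulrA -mulrBr normrM (gtr0_norm t0).
rewrite [e * _]mulrCA ler_wpM2l ?(ltW t0)//.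
have -> : p (x + c *: ei + t *: ej) - p (x + c *: ei) - t * 'd p x ej =
  (p (x + (c *: ei + t *: ej)) - p x - 'd p x (c *: ei + t *: ej)) -
  (p (x + c *: ei) - p x - 'd p x (c *: ei)).
  rewrite linearD addrA [X in _ = _ - (_ + X) - _](_ : _ = t * 'd p x ej).
    ring.
  by rewrite linearZ.
apply: (le_trans (ler_normB _ _)); apply: (le_trans (lerD l1 l2)).
by rewrite [leLHS](_ : _ = e * t)//; field.
Qed.

(** The second difference is symmetric in [i] and [j], and divided by [t ^+ 2] it approximates both
    mixed derivatives. *)
Lemma partial_comm (R : realType) (n : nat) (f : 'rV[R]_n.+1 -> R)
    (x : 'rV[R]_n.+1) (i j : 'I_n.+1) :
  (\forall y \near x, forall k, derivable f y (ebasis R k)) ->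
  (forall k, differentiable (partial f k) x) ->
  partial (partial f i) j x = partial (partial f j) i x.
Proof.
move=> df dp; apply/eqP; rewrite -subr_eq0 -normr_le0; apply/ler_addgt0Pr => e e0.
have df' k : \forall y \near x, derivable f y (ebasis R k).
  by apply: filterS df => y; apply.
have e20 : 0 < e / 2 by rewrite divr_gt0.
have [r1 r10 H1] := @second_difference_approx _ _ _ _ i j _ (df' i) (dp i) e20.
have [r2 r20 H2] := @second_difference_approx _ _ _ _ j i _ (df' j) (dp j) e20.
pose t := Num.min r1 r2 / 2.
have m0 : 0 < Num.min r1 r2 by rewrite lt_min r10.
have t0 : 0 < t by rewrite divr_gt0.
have : t < Num.min r1 r2 by rewrite ltr_pdivrMr// ltr_pMr// ltr1n.
rewrite lt_min => /andP[/(H1 t t0) {}H1 /(H2 t t0) {}H2].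
have t20 : 0 < t ^+ 2 by rewrite exprn_gt0.
rewrite add0r -(ler_pM2l t20) -{1}(gtr0_norm t20) -normrM.
set a := partial _ _ x in H1 *; set b := partial _ _ x in H2 *.
set D1 := (X in `|X - _|) in H1; set D2 := (X in `|X - _|) in H2.
have E : D1 = D2 by rewrite /D1 /D2 [x + _ + _]addrAC; ring.
rewrite (_ : _ * (a - b) = (D2 - t ^+ 2 * b) - (D1 - t ^+ 2 * a)); last first.
  by rewrite E; ring.
apply: (le_trans (ler_normB _ _)); apply: (le_trans (lerD H2 H1)).
by rewrite [leLHS](_ : _ = t ^+ 2 * e)//; field.
Qed.

Lemma taylor2 (R : realType) (n : nat) (f : 'rV[R]_n.+1 -> R)
    (x : 'rV[R]_n.+1) (e : R) :
  (\forall y \near x, differentiable f y) ->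
  (forall k, differentiable (partial f k) x) -> 0 < e ->
  exists2 r : R, 0 < r & forall h, `|h| < r ->
    `|f (x + h) - f x - (h *m (grad f x)^T) 0 0
      - (h *m hess f x *m h^T) 0 0 / 2| <= e * `|h| ^+ 2.
Proof.
move=> /nbhs_normP[r1 /= r10 df] dp e0.
pose e' := e / n.+1%:R.
have e'0 : 0 < e' by rewrite divr_gt0.
have : \forall h \near (0 : 'rV[R]_n.+1), forall k,
    `|partial f k (x + h) - partial f k x - 'd (partial f k) x h| <= e' * `|h|.
  near=> h => k; move: k; near: h; apply: filter_forall => k.
  have [r r0 H] := @diff_approx _ _ _ _ _ (dp k) e'0.
  by apply/(@nbhs_normP R 'rV[R]_n.+1); exists r => // h /=; rewrite sub0r normrN => /H.
move=> /nbhs_normP[r2 /= r20 dpe].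
exists (Num.min r1 r2); first by rewrite lt_min r10.
move=> h; rewrite lt_min => /andP[hr1 hr2].
pose Q := (h *m hess f x *m h^T) 0 0.
(* Subtracting [Q / 2 * t ^+ 2] leaves a function whose derivative at [c], up to the gradient term,
   is the sum of the [h 0 i] times the first-order remainders of [partial f i] at [c *: h]. *)
pose psi (t : R) := f (x + t *: h) - Q / 2 * t ^+ 2.
have hs (t : R) : `|t| <= 1 -> `|t *: h| <= `|h|.
  by move=> t1; rewrite normrZ ler_piMl.
have dxt (t : R) : `|t| <= 1 -> differentiable f (x + t *: h).
  move=> t1; apply: df => /=; rewrite opprD addrA subrr sub0r normrN.
  by rewrite (le_lt_trans (hs _ _)).
have dpsi (t : R) : t \in `[0, 1]%R ->
    is_derive t 1 psi ('d f (x + t *: h) h - Q * t).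
  rewrite in_itv/= => /andP[t0 t1].
  have t1' : `|t| <= 1 by rewrite ger0_norm.
  have -> : 'd f (x + t *: h) h = 'D_1 (fun s : R => f (x + s *: h)) t.
    by rewrite derive_line deriveE//; exact: dxt.
  apply: is_deriveB.
    by apply/derivableP/derivable_line/diff_derivable/dxt.
  apply: is_derive_eq; rewrite /GRing.scale/=; by field.
have cpsi : {within `[0, 1], continuous psi}.
  by apply: derivable_within_continuous => s /dpsi[].
have dpsi' (s : R) : s \in `]0, 1[%R -> is_derive s 1 psi ('d f (x + s *: h) h - Q * s).
  by move=> s01; apply: dpsi; exact: subset_itv_oo_cc.
have [c] := MVT_segment ler01 dpsi' cpsi.
rewrite in_itv/= => /andP[c0 c1].
have c1' : `|c| <= 1 by rewrite ger0_norm.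
rewrite /psi scale1r scale0r addr0 expr1n expr0n/= mulr0 mulr1 subr0 subr0 mulr1.
rewrite diff_partial; last exact: dxt.
move=> E.
rewrite -/Q.
have -> : (h *m (grad f x)^T) 0 0 = \sum_i h 0 i * partial f i x.
  by rewrite mxE; apply: eq_bigr => i _; rewrite !mxE.
have QE : Q = \sum_i h 0 i * 'd (partial f i) x h.
  rewrite /Q -mulmxA mxE; apply: eq_bigr => i _; congr (_ * _).
  rewrite diff_partial// mxE; apply: eq_bigr => j _.
  by rewrite !mxE mulrC.
rewrite (_ : _ - _ = \sum_i h 0 i *
  (partial f i (x + c *: h) - partial f i x - 'd (partial f i) x (c *: h))).
  apply: (le_trans (ler_norm_sum _ _ _)).
  rewrite (_ : e * _ = \sum_(i < n.+1) `|h| * (e' * `|h|)).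
    apply: ler_sum => i _; rewrite normrM ler_pM ?normr_ge0 ?rV_norm_coord//.
    apply: (le_trans (dpe _ _ _)).
      by rewrite /= sub0r normrN (le_lt_trans (hs _ _)).
    by rewrite ler_wpM2l ?hs// ltW.
  have N0 : n.+1%:R != 0 :> R by rewrite pnatr_eq0.
  by rewrite sumr_const card_ord -mulr_natl /e'; move: n.+1%:R N0 => N N0; field.
have dZ i : 'd (partial f i) x (c *: h) = c * 'd (partial f i) x h.
  by rewrite linearZ.
under [in RHS]eq_bigr do rewrite dZ !mulrBr.
rewrite !sumrB.
have -> : \sum_i h 0 i * (c * 'd (partial f i) x h) = Q * c.
  by rewrite QE mulr_suml; apply: eq_bigr => i _; rewrite -mulrA [c * _]mulrC.
move: E; set S1 := \sum_i _; set S2 := \sum_i _ => E.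
have -> : f (x + h) = f x + Q / 2 + (S1 - Q * c) by rewrite -E; ring.
ring.
Unshelve. all: by end_near. Qed.

(** * Quadratic forms: bounds, and definiteness on a kernel *)

Definition sqnorm {R : pzRingType} {n : nat} (u : 'rV[R]_n) : R := \sum_i u 0 i ^+ 2.

Lemma sqnorm_mulmx (R : pzRingType) (n : nat) (u : 'rV[R]_n) :
  sqnorm u = (u *m u^T) 0 0.
Proof. by rewrite mxE; apply: eq_bigr => i _; rewrite mxE expr2. Qed.

Lemma sqnorm_ge0 (R : realDomainType) (n : nat) (u : 'rV[R]_n) : 0 <= sqnorm u.
Proof. by apply: sumr_ge0 => i _; exact: sqr_ge0. Qed.

Lemma sqr_le_sqnorm (R : realDomainType) (n : nat) (u : 'rV[R]_n) (i : 'I_n) :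
  u 0 i ^+ 2 <= sqnorm u.
Proof.
by rewrite /sqnorm (bigD1 i)//= lerDl sumr_ge0// => j _; exact: sqr_ge0.
Qed.

Lemma quadratic_form_bound (R : realFieldType) (n : nat) (M : 'M[R]_n) :
  exists2 b : R, 0 < b & forall u : 'rV[R]_n,
    `|(u *m M *m u^T) 0 0| <= b * sqnorm u.
Proof.
(* The [+ 1] keeps the bound positive even for [M = 0]. *)
exists (\sum_j \sum_i `|M i j| + 1).
  by rewrite ltr_wpDl// sumr_ge0// => j _; apply: sumr_ge0.
move=> u; apply: (@le_trans _ _ ((\sum_j \sum_i `|M i j|) * sqnorm u)); last first.
  by rewrite ler_wpM2r ?sqnorm_ge0// lerDl.
rewrite mxE mulr_suml; apply: (le_trans (ler_norm_sum _ _ _)).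
apply: ler_sum => j _; rewrite mulr_suml !mxE mulr_suml.
apply: (le_trans (ler_norm_sum _ _ _)); apply: ler_sum => i _.
rewrite mulrAC mulrC normrM ler_wpM2l// ler_norml.
have /= := sqr_le_sqnorm _ _ u i; have /= := sqr_le_sqnorm _ _ u j.
have := sqr_ge0 (u 0 i - u 0 j); have := sqr_ge0 (u 0 i + u 0 j).
by move: (u 0 i) (u 0 j) (sqnorm u) => a b q; nra.
Qed.

Lemma sqnorm_mulmx_bound (R : realFieldType) (m n : nat) (M : 'M[R]_(m, n)) :
  exists2 b : R, 0 < b & forall u : 'rV[R]_m, sqnorm (u *m M) <= b * sqnorm u.
Proof.
have [b b0 H] := @quadratic_form_bound _ _ (M *m M^T); exists b => // u.
rewrite sqnorm_mulmx trmx_mul mulmxA -(mulmxA u).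
exact: le_trans (ler_norm _) (H u).
Qed.

Lemma kernel_basis (F : fieldType) (k m : nat) (G : 'M[F]_(m, k + m)) :
  row_free G -> exists2 B : 'M[F]_(k, k + m), B *m G^T = 0 & row_free B.
Proof.
move=> /eqP rG.
have rk : \rank (kermx G^T) = k by rewrite mxrank_ker mxrank_tr rG addnK.
(* The basis first has as many rows as the rank of the kernel; rewriting this whole statement with
   [rk] then avoids a cast of matrices. *)
have H : exists2 B : 'M[F]_(\rank (kermx G^T), k + m), B *m G^T = 0 & row_free B.
  exists (row_base (kermx G^T)); last exact: row_base_free.
  by apply/sub_kermxP; rewrite eq_row_base.
by move: H; rewrite rk.
Qed.

(* Cayley-Hamilton for Q gives tr Q * yQy^T = det Q * |y|^2 + |yQ|^2. *)
Lemma quadratic_form2_ge (R : realFieldType) (Q : 'M[R]_2) (y : 'rV[R]_2) :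
  Q^T = Q -> \det Q * sqnorm y <= \tr Q * (y *m Q *m y^T) 0 0.
Proof.
move=> QT; have Q10 : Q 1 0 = Q 0 1 by rewrite -[in LHS]QT mxE.
rewrite /sqnorm /mxtrace (expand_det_row _ 0) !mxE !big_ord_recl !big_ord0 /=.
rewrite !mxE !big_ord_recl !big_ord0 /cofactor !det_mx11 !mxE /=.
have l1 : lift ord0 ord0 = 1 :> 'I_2 by apply: val_inj.
have l0 : lift 1 ord0 = 0 :> 'I_2 by apply: val_inj.
have o0 : ord0 = 0 :> 'I_2 by apply: val_inj.
rewrite !l1 !l0 !o0 Q10 -[bump 0 0]/1%N !addn0 !expr0 !expr1.
move: (Q 0 0) (Q 0 1) (Q 1 1) (y 0 0) (y 0 1) => a b d y0 y1.
rewrite -subr_ge0 [leRHS](_ : _ = (a * y0 + b * y1) ^+ 2 + (b * y0 + d * y1) ^+ 2).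
  by rewrite addr_ge0 ?sqr_ge0.
ring.
Qed.

(** In the coordinates [u = (y, z) P] the form is [y Q y^T + z D z^T]. The factor [s := \tr Q] has
    the sign of the definite form [Q], so positive and negative definite cases are treated together.
    Since [u G^T = z D] with [D] invertible, the penalty controls [z]. *)
Lemma definite_on_kernel (R : realFieldType) (m : nat) (A : 'M[R]_(2 + m))
    (G : 'M[R]_(m, 2 + m)) :
  A^T = A -> A \in unitmx -> 0 < \det A * \det (G *m invmx A *m G^T) ->
  exists s K c : R, [/\ 0 <= K, 0 < c & forall u : 'rV[R]_(2 + m),
    c * sqnorm u <= s * (u *m A *m u^T) 0 0 + K * sqnorm (u *m G^T)].
Proof.
move=> AT uA; set D := G *m invmx A *m G^T => detAD.
have AVT : (invmx A)^T = invmx A by rewrite trmx_inv AT.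
have detD : \det D != 0.
  by apply: contraTneq detAD => ->; rewrite mulr0 ltxx.
have uD : D \in unitmx by rewrite unitmxE unitfE.
(* [v G = 0] implies [v D = 0], hence [v = 0]: the rows of [G] are independent and its kernel is a
   plane. *)
have [|B BG fB] := @kernel_basis _ 2 m G.
  apply: inj_row_free => v vG; apply: (can_inj (mulmxK uD)).
  by rewrite mul0mx /D !mulmxA vG !mul0mx.
have [S [SG SA GS]] : exists S : 'M[R]_(m, 2 + m),
    [/\ S *m G^T = D, S *m A = G & G *m S^T = D].
  exists (G *m invmx A); split => //; first by rewrite mulmxKV.
  by rewrite trmx_mul AVT mulmxA.
pose P := col_mx B S.
pose Q := B *m A *m B^T.
(* If [y B + z S = 0], multiplying by [G^T] leaves [z D = 0], so [z = 0]; then [y B = 0] gives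
   [y = 0]. *)
have uP : P \in unitmx.
  rewrite -row_free_unit; apply: inj_row_free => v.
  rewrite -[v]hsubmxK mul_row_col => vP.
  have z0 : rsubmx v = 0.
    apply: (can_inj (mulmxK uD)); rewrite mul0mx.
    have := congr1 (mulmx^~ G^T) vP.
    by rewrite mulmxDl -!mulmxA BG SG mulmx0 add0r mul0mx.
  move: vP; rewrite z0 mul0mx addr0 => yB.
  by rewrite (row_free_inj fB (etrans yB (esym (mul0mx _ _)))) row_mx0.
have ST : A *m S^T = G^T by rewrite -[in LHS]AT -trmx_mul SA.
have PAP : P *m A *m P^T = block_mx Q 0 0 D.
  rewrite mul_col_mx tr_col_mx mul_col_row -/Q SA.
  rewrite -!(mulmxA B) ST BG -[G *m B^T]trmxK trmx_mul trmxK BG trmx0.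
  by rewrite GS.
(* Taking determinants gives [\det Q * \det D ^+ 2 = \det P ^+ 2 * (\det A * \det D)]. *)
have detQ : 0 < \det Q.
  have := congr1 determinant PAP.
  rewrite det_ublock !det_mulmx det_tr => E.
  have d2 : 0 < \det D ^+ 2 by rewrite exprn_even_gt0.
  have p2 : 0 < \det P ^+ 2.
    by rewrite exprn_even_gt0//=; rewrite unitmxE unitfE in uP.
  rewrite -(pmulr_lgt0 _ d2) expr2 mulrA -E.
  rewrite (_ : _ * _ = \det P ^+ 2 * (\det A * \det D)); last by ring.
  by rewrite mulr_gt0.
have QT : Q^T = Q by rewrite /Q !trmx_mul trmxK AT mulmxA.
have [M M0 DM] := @quadratic_form_bound _ _ D.
have [C1 C10 HC1] := @sqnorm_mulmx_bound _ _ _ (invmx D).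
have [C2 C20 HC2] := @sqnorm_mulmx_bound _ _ _ P.
set s := \tr Q; set d := \det Q in detQ *.
(* [M] bounds the form [D], [C1] recovers [z] from [z D], and [C2] compares [u] with its
   coordinates. The summand [d] supplies the term [d |z|^2] that the estimate on [y] does not
   give. *)
exists s, ((`|s| * M + d) * C1), (d / C2); split.
- by rewrite mulr_ge0 ?ltW// ltr_wpDl// mulr_ge0// ltW.
- by rewrite divr_gt0.
move=> u; rewrite -[u](mulmxKV uP); set w := u *m invmx P.
set y := lsubmx w; set z := rsubmx w.
have wE : w = row_mx y z by rewrite hsubmxK.
have -> : w *m P *m A *m (w *m P)^T = y *m Q *m y^T + z *m D *m z^T.
  have E : w *m P *m A *m P^T = w *m (P *m A *m P^T) by rewrite !mulmxA.
  rewrite trmx_mul mulmxA E PAP wE.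
  by rewrite mul_row_block !mulmx0 addr0 add0r tr_row_mx mul_row_col.
have wG : w *m P *m G^T = z *m D.
  by rewrite wE mul_row_col mulmxDl -!mulmxA BG SG mulmx0 add0r.
have zC : sqnorm z <= C1 * sqnorm (z *m D).
  by rewrite -[z in leLHS](mulmxK uD).
have wyz : sqnorm w = sqnorm y + sqnorm z.
  rewrite wE /sqnorm big_split_ord /=.
  by congr (_ + _); apply: eq_bigr => i _; rewrite ?row_mxEl ?row_mxEr.
have h1 : d / C2 * sqnorm (w *m P) <= d * sqnorm w.
  by rewrite -mulrA ler_wpM2l ?(ltW detQ)// ler_pdivrMl//; exact: HC2.
have h2 := quadratic_form2_ge _ _ y QT.
have h3 : - (`|s| * M * sqnorm z) <= s * (z *m D *m z^T) 0 0.
  rewrite lerNl -mulrN; apply: (le_trans (ler_norm _)).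
  by rewrite normrM normrN -mulrA ler_wpM2l//; exact: DM.
apply: (le_trans h1); rewrite wG mxE mulrDr wyz.
have h4 : (`|s| * M + d) * sqnorm z <= (`|s| * M + d) * C1 * sqnorm (z *m D).
  by rewrite -[leRHS]mulrA ler_wpM2l// addr_ge0 ?(ltW detQ)// mulr_ge0// ltW.
apply: le_trans (lerD (lerD h2 h3) h4).
by rewrite -/d; lra.
Qed.

(** * Smoothness under differentiation and linear combination *)

Section smooth_functions.
Context {R : realType} {n : nat} (O : set 'rV[R]_n.+1) (openO : open O).
Implicit Types (f g : 'rV[R]_n.+1 -> R) (x y : 'rV[R]_n.+1).

Lemma open_near (P : 'rV[R]_n.+1 -> Prop) x :
  O x -> (forall y, O y -> P y) -> \forall y \near x, P y.
Proof.
by move=> Ox OP; apply: filterS OP _; exact: open_nbhs_nbhs.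
Qed.

Lemma smooth_on_partial f i :
  smooth_on O f -> smooth_on O (partial f i).
Proof.
(* [iter_partial] differentiates first along the last entry of its list, so [i] is appended at the
   end. *)
move=> sf l x Ox; have := sf (rcons l i) x Ox.
by rewrite /iter_partial foldr_rcons.
Qed.

Lemma smooth_on_derivable f x i : smooth_on O f -> O x -> derivable f x (ebasis R i).
Proof. by move=> sf Ox; have [_] := sf [::] x Ox; apply. Qed.

Lemma smooth_on_differentiable f x : smooth_on O f -> O x -> differentiable f x.
Proof.
move=> sf Ox; apply: differentiable_partials => [|i].
  by apply: open_near => // y Oy i; exact: smooth_on_derivable.
by have [] := @smooth_on_partial f i sf [::] x Ox.
Qed.

(** The inductive identity holds on [O] alone, but [O] is open and a derivative depends only on
    values near the point, so it can be differentiated again. *)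
Lemma iter_partial_comb (a : R) f g l x : smooth_on O f -> smooth_on O g -> O x ->
  iter_partial l (fun y => f y + a * g y) x =
  iter_partial l f x + a * iter_partial l g x.
Proof.
move=> sf sg; elim: l x => // i l IH x Ox /=.
rewrite {1}/partial (@near_eq_derive _ _ _ _
  (iter_partial l f + a \*: iter_partial l g)).
  have [_ df] := sf l x Ox; have [_ dg] := sg l x Ox.
  by rewrite deriveD ?deriveZ//; exact: derivableZ.
exact: open_near.
Qed.

Lemma smooth_on_comb (a : R) f g : smooth_on O f -> smooth_on O g ->
  smooth_on O (fun y => f y + a * g y).
Proof.
move=> sf sg l x Ox.
have E : \forall y \near x, (iter_partial l f + a \*: iter_partial l g) y =
    iter_partial l (fun y => f y + a * g y) y.
  by apply: open_near => // y Oy; rewrite iter_partial_comb.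
have [cf df] := sf l x Ox; have [cg dg] := sg l x Ox.
split=> [|i].
  change (iter_partial l (fun y => f y + a * g y) @ x -->
    iter_partial l (fun y => f y + a * g y) x).
  rewrite [X in _ --> X]iter_partial_comb//.
  apply: (cvg_trans (near_eq_cvg E)).
  by apply: cvgD; [exact: cf | apply: cvgM; [exact: cvg_cst | exact: cg]].
apply: near_eq_derivable E _; apply: derivableD; first exact: df.
exact/derivableZ/dg.
Qed.

End smooth_functions.

(** * Conserved quantities and Lyapunov stability *)

Lemma first_integral_cst (R : realType) (n : nat) (O : set 'rV[R]_n.+1)
    (X : 'rV[R]_n.+1 -> 'rV[R]_n.+1) (f : 'rV[R]_n.+1 -> R)
    (T : \bar R) (g : R -> 'rV[R]_n.+1) :
  (forall y, O y -> differentiable f y) ->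
  (forall y, O y -> 'd f y (X y) = 0) ->
  (forall t : R, 0 <= t -> (t%:E < T)%E -> O (g t) /\ is_derive t 1 g (X (g t))) ->
  forall t : R, 0 <= t -> (t%:E < T)%E -> f (g t) = f (g 0).
Proof.
move=> df fX gX t t0 tT.
have dfg (s : R) : s \in `[0, t]%R -> is_derive s 1 (f \o g) 0.
  rewrite in_itv/= => /andP[s0 st].
  have [|Og [dg gE]] := gX s s0; first by rewrite (le_lt_trans _ tT)// lee_fin.
  have {}dg : differentiable g s by apply/derivable1_diffP.
  have dc : differentiable (f \o g) s by apply: differentiable_comp => //; exact: df.
  split; first exact/derivable1_diffP.
  have d1 : 'd g s 1 = X (g s) by rewrite -gE deriveE.
  rewrite deriveE// diff_comp//=; last exact: df.
  by apply: etrans (fX _ Og); congr ('d f (g s) _).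
have cfg : {within `[0, t], continuous (f \o g)}.
  by apply: derivable_within_continuous => s /dfg[].
have dfg' (s : R) : s \in `]0, t[%R -> is_derive s 1 (f \o g) (cst 0 s).
  by move=> s0t; apply: dfg; exact: subset_itv_oo_cc.
have [s _ /eqP] := MVT_segment t0 dfg' cfg.
by rewrite mul0r subr_eq0 => /eqP.
Qed.

(** On the sphere of radius [rho] one has [V >= c * rho ^+ 2], while [V] starts below this value and
    is constant on a trajectory. By continuity, leaving the ball of radius [eps] would require
    crossing that sphere. *)
Lemma lyapunov_conserved (R : realType) (n : nat) (O : set 'rV[R]_n.+1)
    (X : 'rV[R]_n.+1 -> 'rV[R]_n.+1) (xe : 'rV[R]_n.+1)
    (V : 'rV[R]_n.+1 -> R) (c r : R) :
  {for xe, continuous V} -> V xe = 0 -> 0 < c -> 0 < r ->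
  (forall h, `|h| < r -> c * `|h| ^+ 2 <= V (xe + h)) ->
  (forall (T : \bar R) (g : R -> 'rV[R]_n.+1),
    (forall t : R, 0 <= t -> (t%:E < T)%E -> O (g t) /\ is_derive t 1 g (X (g t))) ->
    forall t : R, 0 <= t -> (t%:E < T)%E -> V (g t) = V (g 0)) ->
  lyapunov_stable O X xe.
Proof.
move=> cV V0 c0 r0 Vge Vcst eps eps0.
(* [rho < r] makes the growth bound available on the sphere, and [rho < eps] places the sphere
   inside the target ball. *)
pose rho := Num.min r eps / 2.
have m0 : 0 < Num.min r eps by rewrite lt_min r0.
have rho0 : 0 < rho by rewrite divr_gt0.
have : rho < Num.min r eps by rewrite ltr_pdivrMr// ltr_pMr// ltr1n.
rewrite lt_min => /andP[rhor rhoeps].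
have : \forall y \near xe, V y < c * rho ^+ 2.
  by apply: cvgr_lt cV _ _; rewrite V0 mulr_gt0// exprn_gt0.
move=> /nbhs_normP[d /= d0 Vd].
exists (Num.min d rho); first by rewrite lt_min d0.
move=> T g gX; rewrite lt_min => /andP[g0d g0rho] t t0 tT.
rewrite ltNge; apply/negP => epsg.
have {}Vd : V (g 0) < c * rho ^+ 2 by apply: Vd; rewrite /= distrC.
pose psi (s : R) := `|g s - xe|.
have cpsi : {within `[0, t], continuous psi}.
  apply: continuous_in_subspaceT => s; rewrite inE/= in_itv/= => /andP[s0 st].
  have [|_ [dg _]] := gX s s0; first by rewrite (le_lt_trans _ tT)// lee_fin.
  have {}dg : {for s, continuous g}.
    by apply: differentiable_continuous; apply/derivable1_diffP.
  by apply: cvg_norm; apply: cvgB => //; exact: cvg_cst.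
have [|s] := IVT t0 cpsi (_ : _ <= rho <= _).
  rewrite ge_min (ltW g0rho)/= le_max.
  by rewrite [X in _ || X](le_trans (ltW rhoeps))// orbT.
rewrite in_itv/= => /andP[s0 st] psis.
have sT : (s%:E < T)%E by rewrite (le_lt_trans _ tT)// lee_fin.
have := Vge (g s - xe); rewrite -/(psi s) psis addrC subrK => /(_ rhor).
by rewrite (Vcst T g gX s s0 sT) leNgt Vd.
Qed.

(** * First integrals of the vector field, and the function [F] *)

(** Row [m] of [jac_mx C i x] is [e_i], so its determinant is the cofactor of the entry [(m, i)].
    Weighting these cofactors by [w] is the Laplace expansion along a row [w]. *)
Lemma vfield_sum (R : realType) (m : nat) (nu : 'rV[R]_m.+2 -> R)
    (C : 'I_m.+1 -> 'rV[R]_m.+2 -> R) (x w : 'rV[R]_m.+2) :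
  \sum_i vfield nu C x 0 i * w 0 i =
  nu x * \det (\matrix_(k, j) (if (k < m)%N then grad (C (inord k)) x 0 j
     else if k == m :> nat then w 0 j else grad (C ord_max) x 0 j)).
Proof.
set N := \matrix_(k, j) _.
pose r : 'I_m.+2 := inord m.
have rm : r = m :> nat by rewrite inordK.
rewrite (expand_det_row N r) mulr_sumr; apply: eq_bigr => i _.
rewrite [N r i]mxE rm ltnn eqxx mxE -mulrA [_ * w 0 i]mulrC; congr (_ * (_ * _)).
rewrite (expand_det_row _ r) (bigD1 i)//= big1 => [|j ji].
  rewrite addr0 mxE rm ltnn eqxx mxE !eqxx mul1r; congr (_ * \det _).
  apply/matrixP => a b; rewrite !mxE; case: ifP => // _.
  by rewrite -[X in _ == X]rm (inj_eq val_inj) eq_sym (negbTE (neq_lift _ _)).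
by rewrite mxE rm ltnn eqxx mxE eqxx (negbTE ji) mul0r.
Qed.

Lemma vfield_first_integral (R : realType) (m : nat) (nu : 'rV[R]_m.+2 -> R)
    (C : 'I_m.+1 -> 'rV[R]_m.+2 -> R) (x : 'rV[R]_m.+2) (j : 'I_m.+1) :
  differentiable (C j) x -> 'd (C j) x (vfield nu C x) = 0.
Proof.
move=> dC; rewrite diff_partial//.
have E (i : 'I_m.+2) : partial (C j) i x = grad (C j) x 0 i by rewrite mxE.
under eq_bigr do rewrite E.
rewrite vfield_sum; apply/eqP; rewrite mulf_eq0; apply/orP; right; apply/eqP.
have mm : (m < m.+2)%N by [].
(* Row [m], now the gradient of [C j], repeats row [j] if [j < m], and the last row if [j = m]. *)
have [jm|mj] := ltnP j m.
  have jm2 : (j < m.+2)%N by rewrite (ltn_trans jm).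
  apply: (@determinant_alternate _ _ _ (Ordinal jm2) (Ordinal mm)).
    by rewrite -(inj_eq val_inj)/= ltn_eqF.
  by move=> i; rewrite !mxE/= jm ltnn eqxx inord_val.
apply: (@determinant_alternate _ _ _ ord_max (Ordinal mm)).
  by rewrite -(inj_eq val_inj)/= gtn_eqF.
move=> i; rewrite !mxE/= ltnn eqxx ltnNge leqnSn/= gtn_eqF//.
by rewrite (_ : j = ord_max)//; apply/val_inj/eqP; rewrite eqn_leq mj -ltnS ltn_ord.
Qed.

(** Induction on the list of summation indices reduces both claims to a single combination
    [f + a * g]. *)
Lemma Flam_smooth_grad (R : realType) (m : nat) (O : set 'rV[R]_m.+2)
    (C : 'I_m.+1 -> 'rV[R]_m.+2 -> R) (lam : 'rV[R]_m) :
  open O -> (forall i, smooth_on O (C i)) ->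
  smooth_on O (Flam C lam) /\
  forall x, O x -> grad (Flam C lam) x =
    grad (C ord_max) x + \sum_(i < m) lam 0 i *: grad (firstC C i) x.
Proof.
move=> oO sC; rewrite /Flam.
elim: (index_enum 'I_m) => [|i s [IHs IHg]].
  have -> : (fun x => C ord_max x + \sum_(i <- [::]) lam 0 i * firstC C i x) = C ord_max.
    by apply/funext => x; rewrite big_nil addr0.
  by split=> // x _; rewrite big_nil addr0.
set F := (fun x => C ord_max x + \sum_(j <- s) lam 0 j * firstC C j x) in IHs IHg *.
have -> : (fun x => C ord_max x + \sum_(j <- i :: s) lam 0 j * firstC C j x) =
    (fun x => F x + lam 0 i * firstC C i x).
  by apply/funext => x; rewrite /F big_cons addrCA addrC.
have sfi : smooth_on O (firstC C i) by exact: sC.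
split; first exact: (@smooth_on_comb _ _ _ oO (lam 0 i) F _ IHs sfi).
move=> x Ox; rewrite big_cons addrCA [RHS]addrC -IHg//; apply/rowP => j.
by rewrite !mxE; exact: (@iter_partial_comb _ _ _ oO (lam 0 i) F _ [:: j] x IHs sfi Ox).
Qed.

(** * Quadratic growth of the penalized function *)

(** This passes from the Euclidean norm of the quadratic estimates to the maximum norm of the
    topology. *)
Lemma sqr_norm_le_sqnorm (R : realType) (n : nat) (h : 'rV[R]_n.+1) :
  `|h| ^+ 2 <= sqnorm h.
Proof.
rewrite -[leRHS]sqr_sqrtr ?sqnorm_ge0// lerXn2r ?nnegrE ?sqrtr_ge0//.
apply: rV_norm_le => [|i]; first exact: sqrtr_ge0.
by rewrite -sqrtr_sqr ler_wsqrtr// sqr_le_sqnorm.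
Qed.

Lemma hess_sym (R : realType) (n : nat) (O : set 'rV[R]_n.+1)
    (f : 'rV[R]_n.+1 -> R) (x : 'rV[R]_n.+1) :
  open O -> smooth_on O f -> O x -> (hess f x)^T = hess f x.
Proof.
move=> oO sf Ox; apply/matrixP => i j; rewrite !mxE; apply: partial_comm => [|k].
  by apply: (@open_near _ _ _ oO _ _ Ox) => y Oy k; exact: (@smooth_on_derivable _ _ O).
exact: (@smooth_on_differentiable _ _ O oO _ x (@smooth_on_partial _ _ O f k sf) Ox).
Qed.

(* The conclusion has 2 K, not K, because of the loss in
   [a^2 >= b^2 / 2 - (a - b)^2], used with [b] the linear part of [a]. *)
Lemma penalized_quadratic_growth (R : realType) (n m : nat) (O : set 'rV[R]_n.+1)
    (F : 'rV[R]_n.+1 -> R) (G : 'I_m -> 'rV[R]_n.+1 -> R) (x : 'rV[R]_n.+1)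
    (s K c : R) :
  open O -> smooth_on O F -> (forall i, smooth_on O (G i)) -> O x ->
  grad F x = 0 -> 0 <= K -> 0 < c ->
  (forall h, c * sqnorm h <=
    s * (h *m hess F x *m h^T) 0 0 + K * sqnorm (h *m (gradmx G x)^T)) ->
  exists2 r : R, 0 < r & forall h, `|h| < r ->
    c / 2 * `|h| ^+ 2 <= 2 * s * (F (x + h) - F x) +
      2 * K * \sum_i (G i (x + h) - G i x) ^+ 2.
Proof.
move=> oO sF sG Ox gF K0 c0 posdef.
have dG i : differentiable (G i) x by exact: (@smooth_on_differentiable _ _ O oO _ x (sG i) Ox).
(* [e1] and [e2] make the errors on [F] and on the penalty at most [c / 4 * |h| ^+ 2] each, which
   leaves [c / 2]. The bound [e2 <= 1] serves to replace [e2 ^+ 2] by [e2]. *)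
pose e1 := c / (8 * (`|s| + 1)).
have e10 : 0 < e1 by rewrite divr_gt0// mulr_gt0// ltr_wpDl.
pose e2 : R := Num.min 1 (c / (8 * (K * m%:R + 1))).
have Km0 : 0 < K * m%:R + 1 by rewrite ltr_wpDl// mulr_ge0.
have e20 : 0 < e2 by rewrite lt_min ltr01 divr_gt0// mulr_gt0.
have [r1 r10 HF] : exists2 r : R, 0 < r & forall h, `|h| < r ->
    `|F (x + h) - F x - (h *m (grad F x)^T) 0 0
      - (h *m hess F x *m h^T) 0 0 / 2| <= e1 * `|h| ^+ 2.
  apply: taylor2 => // [|k].
    by apply: (@open_near _ _ _ oO _ _ Ox) => y; exact: (@smooth_on_differentiable _ _ O oO F y sF).
  exact: (@smooth_on_differentiable _ _ O oO _ x (@smooth_on_partial _ _ O F k sF) Ox).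
have : \forall h \near (0 : 'rV[R]_n.+1), forall i,
    `|G i (x + h) - G i x - 'd (G i) x h| <= e2 * `|h|.
  near=> h => i; move: i; near: h; apply: filter_forall => i.
  have [r r0 H] := @diff_approx _ _ _ _ _ (dG i) e20.
  by apply/(@nbhs_normP R 'rV[R]_n.+1); exists r => // h /=; rewrite sub0r normrN => /H.
move=> /nbhs_normP[r2 /= r20 HG].
exists (Num.min r1 r2); first by rewrite lt_min r10.
move=> h; rewrite lt_min => /andP[hr1 hr2].
have {HF} := HF h hr1; rewrite gF trmx0 mulmx0 [in X in `|X|]mxE subr0.
have {HG}HG i : `|G i (x + h) - G i x - 'd (G i) x h| <= e2 * `|h|.
  by apply: HG; rewrite /= sub0r normrN.
have {posdef} := posdef h.
have -> : sqnorm (h *m (gradmx G x)^T) = \sum_i 'd (G i) x h ^+ 2.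
  apply: eq_bigr => i _; rewrite diff_partial// mxE; congr (_ ^+ 2).
  by apply: eq_bigr => j _; rewrite !mxE.
set q := (h *m hess F x *m h^T) 0 0; set dF := F (x + h) - F x.
set S := \sum_i 'd (G i) x h ^+ 2; set S' := \sum_i _.
have := sqr_norm_le_sqnorm _ _ h; set N := `|h| ^+ 2 => hN posdef HF.
have N0 : 0 <= N by exact: exprn_ge0.
have hc : c * N <= s * q + K * S.
  by apply: le_trans posdef; rewrite ler_wpM2l// ltW.
have SS : S / 2 - m%:R * (e2 * N) <= S'.
  rewrite (_ : m%:R * _ = \sum_(i < m) e2 * N).
    2: by rewrite sumr_const card_ord mulr_natl.
  rewrite /S mulr_suml -sumrB.
  apply: ler_sum => i _; have := HG i.
  set a := G i (x + h) - G i x; set b := 'd (G i) x h => ab.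
  have {}ab : (a - b) ^+ 2 <= e2 * N.
    rewrite -real_normK ?num_real//.
    apply: (@le_trans _ _ ((e2 * `|h|) ^+ 2)).
      by rewrite lerXn2r ?nnegrE// mulr_ge0// ltW.
    by rewrite exprMn ler_wpM2r// expr2 ler_piMl ?(ltW e20)// ge_min lexx.
  (* Indeed [a^2 + (a - b)^2 - b^2 / 2 = (2 a - b)^2 / 2]. *)
  have := sqr_ge0 (2 * a - b); lra.
have h1 : `|2 * s * (dF - q / 2)| <= c / 4 * N.
  rewrite normrM; apply: (le_trans (ler_wpM2l (normr_ge0 _) HF)).
  rewrite mulrA ler_wpM2r// normrM ger0_norm//.
  rewrite /e1 mulrA ler_pdivrMr; last by rewrite mulr_gt0// ltr_wpDl.
  by have := normr_ge0 s; move: `|s| => a a0; nra.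
have h2 : 2 * K * (m%:R * (e2 * N)) <= c / 4 * N.
  rewrite [leLHS](_ : _ = 2 * K * m%:R * e2 * N); last by ring.
  rewrite ler_wpM2r//.
  have : e2 * (8 * (K * m%:R + 1)) <= c.
    by rewrite -ler_pdivlMr ?mulr_gt0// ge_min lexx orbT.
  by move: (ltW e20); lra.
have h3 : 2 * K * (S / 2 - m%:R * (e2 * N)) <= 2 * K * S'.
  by rewrite ler_wpM2l// mulr_ge0.
move: h1; rewrite ler_norml => /andP[h1 _]; lra.
Unshelve. all: by end_near. Qed.

Theorem theorem5p6 (R : realType) (m : nat) (Omega : set 'rV[R]_m.+2)
  (nu : 'rV[R]_m.+2 -> R) (C : 'I_m.+1 -> 'rV[R]_m.+2 -> R)
  (xe : 'rV[R]_m.+2) (lam : 'rV[R]_m) :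
  open Omega ->
  smooth_on Omega nu ->
  (forall i, smooth_on Omega (C i)) ->
  equil_set Omega nu C xe ->
  vfield nu C xe = 0 ->
  grad (C ord_max) xe + \sum_(i < m) lam 0 i *: grad (firstC C i) xe = 0 ->
  hess (Flam C lam) xe \in unitmx ->
  0 < index_IX nu C lam xe ->
  lyapunov_stable Omega (vfield nu C) xe.
Proof.
move=> oO _ sC [Oxe _] _ gF0 uA idx.
have [sF gF] := @Flam_smooth_grad _ _ _ _ lam oO sC.
set F := Flam C lam in uA sF gF *; set A := hess F xe in uA.
set G := gradmx (firstC C) xe.
have AT : A^T = A by exact: hess_sym oO sF Oxe.
(* As [A] is symmetric, the pairing is [\det (G A^-1 G^T)]; as [nu xe ^+ 2 >= 0], a positive index
   forces the other factor to be positive. *)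
have detAD : 0 < \det A * \det (G *m invmx A *m G^T).
  move: idx; rewrite /index_IX /kpairing -/F -/A -/G trmx_inv AT -mulrA.
  set D := \matrix_(i, j) _; have -> : D = G *m invmx A *m G^T.
    apply/matrixP => i j; rewrite /D mxE [RHS]mxE; apply: eq_bigr => l _.
    by rewrite [G^T _ _]mxE.
  by apply: contraTT; rewrite -!leNgt; apply: mulr_ge0_le0; exact: sqr_ge0.
have [s [K [c [K0 c0 posdef]]]] := @definite_on_kernel R m A G AT uA detAD.
have sfC i : smooth_on Omega (firstC C i) by exact: sC.
have [|r r0 growth] := @penalized_quadratic_growth _ _ _ _ F (firstC C) xe s K c
  oO sF sfC Oxe _ K0 c0 posdef; first by rewrite gF.
pose V x := 2 * s * (F x - F xe) +
  2 * K * \sum_i (firstC C i x - firstC C i xe) ^+ 2.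
have contC f : smooth_on Omega f -> {for xe, continuous f}.
  by move=> sf; have [] := sf [::] xe Oxe.
apply: (@lyapunov_conserved _ _ _ _ _ V (c / 2) r) => //.
- have cB f : smooth_on Omega f -> (fun x => f x - f xe) @ xe --> f xe - f xe.
    move=> sf; exact: (cvgB (contC f sf) (cvg_cst (f xe))).
  have cF : (fun x => 2 * s * (F x - F xe)) @ xe --> 2 * s * (F xe - F xe).
    exact: (cvgM (cvg_cst (2 * s)) (cB F sF)).
  have cC : (fun x => \sum_i (firstC C i x - firstC C i xe) ^+ 2) @ xe -->
      \sum_i (firstC C i xe - firstC C i xe) ^+ 2.
    exact: (@cvg_big _ _ +%R 0 xpredT add_continuous _ (nbhs xe) (index_enum 'I_m)
      (fun i x => (firstC C i x - firstC C i xe) ^+ 2) _ _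
      (fun i _ => cvgM (cB _ (sfC i)) (cB _ (sfC i)))).
  exact: (cvgD cF (cvgM (cvg_cst (2 * K)) cC)).
- rewrite /V subrr mulr0 add0r big1 ?mulr0// => i _.
  by rewrite subrr expr0n.
- by rewrite divr_gt0.
move=> T g gX t t0 tT.
have cstC i : C i (g t) = C i (g 0).
  have dC y : Omega y -> differentiable (C i) y.
    exact: (@smooth_on_differentiable _ _ Omega oO _ y (sC i)).
  apply: first_integral_cst gX t t0 tT => // y Oy.
  exact/vfield_first_integral/dC.
(* [V] depends on the point only through the values of the [C i], all constant along [g]. *)
rewrite /V /F /Flam cstC /firstC.
by under eq_bigr do rewrite cstC; under [in X in _ + X]eq_bigr do rewrite cstC.
Qed.
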